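(* Let $k\ge 2$ be an integer and $i_1,\dots,i_k$ real numbers with each $i_j>1$ and $i_1+\dots+i_k>k+1$. Then \[ \sum_{n=1}^\infty\prod_{j=1}^k\left(\zeta(i_j)-\sum_{m=1}^n\frac1{m^{i_j}}\right)= \sum_{\sigma\in\Sigma_k}\sum_{J\in\mathcal C_k}\hat\zeta\big((i_{\sigma(1)},\dots,i_{\sigma(k)}),J\big) -\prod_{j=1}^k\zeta(i_j) . \]
   Context: $\zeta$ denotes the Riemann zeta function, and for real $a_1,\dots,a_m$ the multiple zeta value is $\zeta(a_1,\dots,a_m)=\sum_{n_1>n_2>\dots>n_m\ge 1} n_1^{-a_1}\cdots n_m^{-a_m}$. $\Sigma_k$ is the symmetric group on $\{1,\dots,k\}$, and $\mathcal C_k$ is the set of compositions of $k$, i.e. sequences $(j_1,\dots,j_p)$ of positive integers with $j_1+\dots+j_p=k$. For a sequence $I=(a_1,\dots,a_k)$ of positive reals and $J=(j_1,\dots,j_p)\in\mathcal C_k$, set $J_c(I)=a_{j_1+\dots+j_{c-1}+1}+\dots+a_{j_1+\dots+j_c}$ for $c=1,\dots,p$, and \[ \hat\zeta(I,J)=\frac{\zeta(J_1(I),J_2(I),\dots,J_{p-1}(I),J_p(I)-1)}{j_1!\cdots j_p!}. \] *)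

(* Defs.v *)
From HB Require Import structures.
From mathcomp Require Import all_boot all_order all_algebra all_fingroup.
From mathcomp Require Import all_classical all_reals all_analysis.

Set Implicit Arguments.
Unset Strict Implicit.
Unset Printing Implicit Defensive.

Import Order.TTheory GRing.Theory Num.Theory.
Import numFieldNormedType.Exports.

Local Open Scope classical_set_scope.
Local Open Scope ring_scope.

Definition is_composition (k : nat) (J : seq nat) : bool :=
  all (fun j => 0 < j)%N J && (sumn J == k).

Record composition (k : nat) : Type := Composition {
  parts :> seq nat;
  _ : is_composition k parts }.

HB.instance Definition _ (k : nat) := [isSub for @parts k].
HB.instance Definition _ k := [Countable of composition k by <:].

(* Finiteness: a composition of k has at most k parts, each of them at most
   k, so it is recorded faithfully by a bounded sequence over 'I_k.+1. *)
Definition bseq_of_composition k (J : composition k) : k.-bseq 'I_k.+1 :=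
  insub_bseq k [seq inord j | j <- J].

Definition composition_of_bseq k (b : k.-bseq 'I_k.+1) :
  option (composition k) := insub [seq val j | j <- b].

Lemma bseq_of_compositionK k :
  pcancel (@bseq_of_composition k) (@composition_of_bseq k).
Proof.
move=> [J HJ]; have /andP[/allP Jpos /eqP Jsum] := HJ.
have sizeJ (s : seq nat) :
    (forall j, j \in s -> 0 < j)%N -> (size s <= sumn s)%N.
  elim: s => //= j s IHs s_pos; rewrite -add1n leq_add ?s_pos ?mem_head//.
  by apply: IHs => j' j's; rewrite s_pos// in_cons j's orbT.
have leJ (s : seq nat) j : j \in s -> (j <= sumn s)%N.
  elim: s => //= j' s IHs; rewrite in_cons => /predU1P[->|/IHs js].
    exact: leq_addr.
  exact: leq_trans js (leq_addl _ _).
rewrite /composition_of_bseq /bseq_of_composition /insub_bseq /=.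
have Jk : (size J <= k)%N by rewrite -Jsum sizeJ.
rewrite val_insubd size_map Jk -map_comp.
have -> : map (val \o @inord k) J = J.
  rewrite -[RHS]map_id; apply/eq_in_map => j /leJ; rewrite Jsum => jk /=.
  by rewrite inordK.
by rewrite (insubT (is_composition k)).
Qed.

HB.instance Definition _ k :=
  fintype.isFinite.Build (composition k) (pcan_enumP (@bseq_of_compositionK k)).

(* Intended for s > 1. *)
Definition zeta (R : realType) (s : R) : R :=
  limn (fun N => \sum_(1 <= n < N.+1) (n%:R `^ s)^-1).

Definition mzv_index (m : nat) : set (seq nat) :=
  [set n | [/\ size n = m, sorted gtn n & all (fun x => 0 < x)%N n]].

(* The terms are nonnegative, so the unordered sum always makes sense in
   [0, +oo]; the multiple zeta value converges iff this is finite. *)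
Definition mzv (R : realType) (a : seq R) : \bar R :=
  \esum_(n in mzv_index (size a))
    (\prod_(l < size a) (nth 0%N n l)%:R `^ (- a`_l))%:E.

(* Positions are counted from 0: for c < size J, block_sum I J c is
   J_{c+1}(I), and I`_l is a_{l+1}. *)
Definition block_sum (R : realType) (I : seq R) (J : seq nat) (c : nat) : R :=
  \sum_(sumn (take c J) <= l < sumn (take c.+1 J)) I`_l.

(* (J_1(I), ..., J_{p-1}(I), J_p(I) - 1) *)
Definition zeta_hat_args (R : realType) (I : seq R) (J : seq nat) : seq R :=
  mkseq (fun c => block_sum I J c - (c.+1 == size J)%:R) (size J).

(* fine sends +oo to 0: only meaningful when the multiple zeta value at
   zeta_hat_args I J is finite. *)
Definition zeta_hat (R : realType) (I : seq R) (J : seq nat) : R :=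
  fine (mzv (zeta_hat_args I J)) / \prod_(j <- J) (j`!)%:R.

(* Main.v *)
Require Import Defs.
From HB Require Import structures.
From mathcomp Require Import all_boot all_order all_algebra all_fingroup.
From mathcomp Require Import all_classical all_reals all_analysis.
From mathcomp Require Import ring.
Import Order.TTheory GRing.Theory Num.Theory.
Import numFieldNormedType.Exports.
Local Open Scope classical_set_scope.
Local Open Scope ring_scope.

(* Expanding the product of the tails, the left-hand side counts each k-tuple m
   of positive integers, with weight W(m) = prod_j m_j^-(i_j), once for every
   1 <= n < min m; adding prod_j zeta(i_j), the term n = 0, gives
   sum_m (min m) W(m).
   Sorting m into a decreasing sequence with blocks of equal values n_1 > ... >
   n_p of lengths J = (j_1, ..., j_p) turns (min m) W(m) into the term of index
   (n_1, ..., n_p) of the multiple zeta value attached to J, and exactly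
   j_1! ... j_p! permutations sort m. Everything is summed in [0, +oo], and
   finiteness comes from bounding min m by a weighted geometric mean. *)

(** * Sums of nonnegative families in [0, +oo] *)

Lemma subset_esum (R : realType) (T : choiceType) (A B : set T)
    (a : T -> \bar R) :
  A `<=` B -> (forall x, B x -> 0 <= a x)%E ->
  (\esum_(x in A) a x <= \esum_(x in B) a x)%E.
Proof.
move=> AB a0; rewrite (esumID A B)// setIC (setIidl AB) leeDl// esum_ge0//.
by move=> x [Bx _]; exact: a0.
Qed.

Lemma esumZl (R : realType) (T : choiceType) (A : set T) (a : T -> \bar R)
    (r : R) : 0 <= r -> (forall x, 0 <= a x)%E ->
  \esum_(x in A) (r%:E * a x)%E = (r%:E * \esum_(x in A) a x)%E.
Proof.
move=> r0 a0; rewrite /esum -ereal_supZl//; last first.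
  (* Scaling commutes with a supremum over a nonempty set; the empty sum is a member. *)
  apply/set0P; exists (\sum_(x \in set0) a x)%E, set0 => //.
  exact: fsets_set0.
congr ereal_sup; apply/seteqP; split => y /=.
  move=> [X XA <-]; exists (\sum_(x \in X) a x)%E; first by exists X.
  by rewrite ge0_mule_fsumr.
by move=> [_ [X XA <-] <-]; exists X => //; rewrite ge0_mule_fsumr.
Qed.

Lemma esum_finType (R : realType) (T : finType) (a : T -> \bar R) :
  (forall x, 0 <= a x)%E -> \esum_(x in [set: T]) a x = (\sum_x a x)%E.
Proof.
move=> a0; rewrite esum_fset//; last exact: finite_finset.
have {1}-> : [set: T] = [set` enum T].
  by apply/seteqP; split => x //= _; rewrite mem_enum.
by rewrite -fsbig_seq ?enum_uniq// big_enum.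
Qed.

Lemma exchange_esum (R : realType) (S T : choiceType) (A : set S) (B : set T)
    (a : S -> T -> \bar R) : (forall x y, 0 <= a x y)%E ->
  \esum_(x in A) \esum_(y in B) a x y = \esum_(y in B) \esum_(x in A) a x y.
Proof.
move=> a0; rewrite !esum_esum//.
rewrite (@reindex_esum _ _ _ (B `*`` fun=> A) (A `*`` fun=> B)
  (fun p => (p.2, p.1)))//; split.
- by move=> [x y] [].
- by move=> [x y] [x' y'] _ _ /= [-> ->].
- by move=> [x y] [Ax By]; exists (y, x).
Qed.

(* Every finite set of tuples lies in a box [0, N)^k, over which the sum of
   the products is the product of the sums. *)
Lemma esum_tuple_prod (R : realType) (k : nat) (f : 'I_k -> nat -> R)
    (c : 'I_k -> R) :
  (forall j n, 0 <= f j n) ->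
  (forall j, (fun N => \sum_(0 <= n < N) f j n) @ \oo --> c j) ->
  \esum_(m in [set: k.-tuple nat]) (\prod_(j < k) f j (tnth m j))%:E =
  (\prod_(j < k) c j)%:E.
Proof.
move=> f0 fc; pose F (m : k.-tuple nat) : \bar R :=
  (\prod_(j < k) f j (tnth m j))%:E.
have F0 m : (0 <= F m)%E by rewrite lee_fin prodr_ge0.
pose box N := [set m : k.-tuple nat | forall j, (tnth m j < N)%N].
have sum_box N :
    \esum_(m in box N) F m = (\prod_(j < k) \sum_(0 <= n < N) f j n)%:E.
  (* Tuples in the box are the functions from ['I_k] to ['I_N], so distributivity makes their sum a
     product of sums. *)
  pose e (g : {ffun 'I_k -> 'I_N}) := [tuple val (g j) | j < k].
  rewrite (@reindex_esum _ _ _ setT _ e); last first.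
    split.
    - by move=> g _ j; rewrite tnth_mktuple ltn_ord.
    - move=> g h _ _ /= gh; apply/ffunP => j; apply/val_inj.
      by have := congr1 (fun t => tnth t j) gh; rewrite !tnth_mktuple.
    - move=> m mN; exists [ffun j => Ordinal (mN j)] => //.
      by apply: eq_from_tnth => j; rewrite tnth_mktuple ffunE.
  rewrite esum_finType// sumEFin; congr EFin.
  under [RHS]eq_bigr do rewrite big_mkord.
  rewrite bigA_distr_bigA/=; apply: eq_bigr => g _; apply: eq_bigr => j _.
  by rewrite tnth_mktuple.
have cvg_box : (fun N => \prod_(j < k) \sum_(0 <= n < N) f j n) @ \oo -->
    \prod_(j < k) c j.
  by apply: cvg_big => [|j _]; [exact: mul_continuous|exact: fc].
have nd : {homo (fun N => \prod_(j < k) \sum_(0 <= n < N) f j n) :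
    n m / (n <= m)%N >-> n <= m}.
  move=> n m nm; apply: ler_prod => j _; rewrite sumr_ge0//=.
  by rewrite (big_cat_nat (n := n) (p := m))//= lerDl sumr_ge0.
apply/eqP; rewrite eq_le; apply/andP; split.
  rewrite ge_ereal_sup//= => _ [X [Xfin _] <-].
  (* One more than the largest entry occurring in [X], so that [X] lies in [box M]. *)
  pose M :=
    (\max_(m <- finmap.enum_fset (fset_set X)) \max_(j < k) tnth m j).+1%N.
  apply: (@le_trans _ _ (\esum_(m in box M) F m)).
    apply: esum_ge; exists X => //; split => // m Xm j.
    have mX : m \in finmap.enum_fset (fset_set X).
      by rewrite in_fset_set// inE.
    rewrite ltnS; apply: leq_trans (leq_bigmax_seq _ mX isT).
    exact: (leq_bigmax (F := fun j => tnth m j)).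
  rewrite sum_box lee_fin -(cvg_lim _ cvg_box)//.
  by apply: nondecreasing_cvgn_le => //; apply/cvg_ex; eexists; exact: cvg_box.
have cvg_boxE : (fun N => \esum_(m in box N) F m) @ \oo -->
    (\prod_(j < k) c j)%:E.
  apply: cvg_EFin; first by apply: nearW => N; rewrite sum_box.
  by under [X in X @ _]eq_fun do rewrite /= sum_box.
rewrite -(cvg_lim _ cvg_boxE)//; apply: lime_le.
  by apply/cvg_ex; eexists; exact: cvg_boxE.
by apply: nearW => N; apply: subset_esum.
Qed.

(** * Convergence of the zeta series for exponents above 1 *)

(** The ratio of n^-t to (n+1)^-t is exp x >= 1 + x with x = t (ln (n+1) - ln n), and ln (n+1) - ln
    n >= 1/(n+1) by ln (1 + y) <= y at y = -1/(n+1). For t = s - 1 a term of the zeta series is thus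
    bounded by a telescoping difference. *)
Lemma powRN_le_telescope (R : realType) (t : R) (n : nat) :
  0 <= t -> (0 < n)%N ->
  t * n.+1%:R `^ (- (t + 1)) <= n%:R `^ (- t) - n.+1%:R `^ (- t).
Proof.
move=> t0 n0; have n0R : (0 : R) < n%:R by rewrite ltr0n.
have n1R : (0 : R) < n.+1%:R by rewrite ltr0n.
rewrite opprD powRD ?lt0r_neq0 ?implybT// powR_inv1 ?(ltW n1R)// lerBrDl.
have -> : n%:R `^ (- t) =
    n.+1%:R `^ (- t) * expR (t * (ln n.+1%:R - ln n%:R)) :> R.
  rewrite /powR !gt_eqF// -expRD.
  by congr expR; ring.
rewrite mulrCA -{1}[n.+1%:R `^ (- t)]mulr1 -mulrDr ler_wpM2l ?powR_ge0//.
apply: le_trans (expR_ge1Dx _); rewrite lerD2l ler_wpM2l//.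
have -> : ln n.+1%:R - ln n%:R = - ln (1 + - n.+1%:R^-1) :> R.
  rewrite -opprB -ln_div ?posrE//; congr (- ln _).
  by rewrite -natr1; field; rewrite natr1 gt_eqF.
rewrite lerNr; apply: le_ln1Dx.
by rewrite ltrN2 invf_lt1// ltr1n ltnS.
Qed.

Lemma zeta_cvg (R : realType) (s : R) : 1 < s ->
  (fun N => \sum_(1 <= n < N.+1) (n%:R `^ s)^-1) @ \oo --> zeta s.
Proof.
move=> s1; apply: nondecreasing_is_cvgn.
  move=> n m nm; rewrite [leRHS](big_cat_nat (n := n.+1))//= lerDl sumr_ge0//.
exists (1 + (s - 1)^-1) => _ [N _ <-].
have t0 : 0 < s - 1 by rewrite subr_gt0.
apply: (@le_trans _ _ (\sum_(1 <= n < N.+2) (n%:R `^ s)^-1)).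
  by rewrite [leRHS]big_nat_recr//= lerDl invr_ge0 powR_ge0.
(* The bound carried by the telescoping induction on [N], an equality at N = 0. *)
apply: (@le_trans _ _ (1 + (1 - N.+1%:R `^ (- (s - 1))) / (s - 1))); last first.
  by rewrite lerD2l ler_pdivrMr// mulVf ?gt_eqF// lerBlDr lerDl powR_ge0.
elim: N => [|N IH].
  by rewrite big_nat1 !powR1 subrr mul0r addr0 invr1.
have := @powRN_le_telescope R (s - 1) N.+1 (ltW t0) isT.
rewrite subrK mulrC -ler_pdivlMr// powRN => tele.
rewrite big_nat_recr//=; apply: le_trans (lerD IH tele) _.
by rewrite le_eqVlt; apply/orP; left; apply/eqP; ring.
Qed.

(** * Counting permutations that realize a given rearrangement *)

Lemma geq_trans : transitive geq.
Proof. exact: rev_trans leq_trans. Qed.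

Lemma geq_anti : antisymmetric geq.
Proof. by move=> a b; rewrite andbC; exact: anti_leq. Qed.

Lemma geq_total : total geq.
Proof. by move=> a b; exact: leq_total. Qed.

(* The number of permutations of the positions of s leaving s unchanged. *)
Definition mult_fact {T : eqType} (s : seq T) : nat :=
  (\prod_(x <- undup s) (count_mem x s)`!)%N.

(** Only the multiplicity of [x] changes, from c to c + 1, and (c + 1)! = (c + 1) c!. *)
Lemma mult_fact_cons {T : eqType} (x : T) (s : seq T) :
  mult_fact (x :: s) = ((count_mem x s).+1 * mult_fact s)%N.
Proof.
have other (r : seq T) : x \notin r ->
    (\prod_(y <- r) (count_mem y (x :: s))`! =
     \prod_(y <- r) (count_mem y s)`!)%N.
  move=> xr; apply: eq_big_seq => y yr /=.
  by rewrite (negbTE (memPnC xr y yr)).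
rewrite /mult_fact [undup (x :: s)]/=; case: ifP => xs; last first.
  by rewrite big_cons other ?mem_undup ?xs//= eqxx (count_memPn _) ?xs.
have xu : x \in undup s by rewrite mem_undup.
rewrite !(perm_big _ (perm_to_rem xu)) !big_cons other; last first.
  by rewrite mem_rem_uniqF ?undup_uniq.
by rewrite /= eqxx add1n factS mulnA.
Qed.

(** Induction on [k]: position 0 must go to some j with v j = w 0, for which there are as many
    choices as occurrences of w 0 in [w]; the rest is the same problem on the remaining
    positions. *)
Lemma card_perm_comp {T : eqType} {k : nat} (v w : 'I_k -> T) :
  (forall x, \sum_l (v l == x) = \sum_l (w l == x))%N ->
  (\sum_(s : {perm 'I_k}) [forall l, v (s l) == w l])%N = mult_fact (codom w).
Proof.
elim: k v w => [|k IH] v w vw.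
  rewrite /mult_fact codomE enum_ord0 big_nil (eq_bigr (fun=> 1%N)) => [|s _].
    by rewrite sum1_card card_Sn.
  by rewrite (_ : [forall l, _])//; apply/forallP => -[].
have sumE (u : 'I_k.+1 -> T) j x :
    (\sum_l (u l == x) = (u j == x) + \sum_l (u (lift j l) == x))%N.
  by rewrite (bigD1_ord j).
pose w' := w \o lift ord0.
rewrite codomE enum_ordSl/= -map_comp -/w' -codomE mult_fact_cons.
have -> : (count_mem (w ord0) (codom w')).+1 = (\sum_j (v j == w ord0))%N.
  rewrite vw (sumE _ ord0) eqxx add1n; congr _.+1.
  rewrite codomE count_map -size_filter -sum1_size big_filter big_enum_cond/=.
  by rewrite -big_mkcond.
(* A permutation of k + 1 positions amounts to the image j of 0 and a permutation of the rest. *)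
pose f (p : 'I_k.+1 * 'S_k) := lift_perm ord0 p.1 p.2.
have f_bij : bijective f.
  apply: inj_card_bij => [[j s] [j' s'] /permP fE|]; last first.
    by rewrite card_prod card_ord !card_Sn.
  have jj' : j = j' by have := fE ord0; rewrite /f !lift_perm_id.
  rewrite {}/f -{}jj' in fE *; congr pair; apply/permP => l.
  by have := fE (lift ord0 l); rewrite !lift_perm_lift => /lift_inj.
rewrite (reindex f)/=; last exact: onW_bij.
rewrite -(pair_bigA _ (fun j s => [forall l, v (f (j, s) l) == w l] : nat))/=.
rewrite big_distrl/=; apply: eq_bigr => j _.
have fE s : [forall l, v (f (j, s) l) == w l] =
    (v j == w ord0) && [forall l, (v \o lift j) (s l) == w' l].
  apply/forallP/andP => [vw0|[vj /forallP vw0] l].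
    split; first by have := vw0 ord0; rewrite /f lift_perm_id.
    by apply/forallP => l; have := vw0 (lift ord0 l); rewrite /f lift_perm_lift.
  case: (unliftP ord0 l) => [l'|] ->; rewrite /f/= ?lift_perm_id//.
  by rewrite lift_perm_lift; exact: vw0.
under eq_bigr do rewrite fE.
case: eqVneq => [vj|_] /=; last by rewrite big1.
rewrite mul1n -(IH (v \o lift j) w')// => x.
by have := vw x; rewrite (sumE v j) (sumE w ord0) vj => /addnI.
Qed.

(** * Nonincreasing sequences as blocks over decreasing sequences *)

(* The sequence taking the value n_c on the c-th block of J. *)
Definition expand (J n : seq nat) : seq nat :=
  flatten [seq nseq p.1 p.2 | p <- zip J n].

Lemma size_expand {J n : seq nat} : size n = size J ->
  size (expand J n) = sumn J.
Proof.
elim: J n => [|j J IH] [|x n]//= [/IH].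
by rewrite /expand/= size_cat size_nseq => ->.
Qed.

Lemma mem_expand {J n : seq nat} :
  size n = size J -> all (ltn 0) J -> expand J n =i n.
Proof.
elim: J n => [|j J IH] [|x n]//= [sn] /andP[j0 J0] y.
by rewrite /expand/= mem_cat mem_nseq j0/= in_cons -[in RHS]IH.
Qed.

Lemma undup_expand {J n : seq nat} :
  size n = size J -> all (ltn 0) J -> uniq n -> undup (expand J n) = n.
Proof.
elim: J n => [|j J IH] [|x n]//= [sn] /andP[j0 J0] /andP[xn un].
rewrite /expand/= undup_cat -/(expand J n) IH//.
suff -> : undup (nseq j x) = [:: x] by rewrite /= mem_expand// xn.
case: j j0 => // j _; elim: j => // j IHj.
by rewrite -[in RHS]IHj [LHS]/= in_cons eqxx.
Qed.

Lemma count_expand {J n : seq nat} : size n = size J -> uniq n ->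
  [seq count_mem x (expand J n) | x <- n] = J.
Proof.
elim: J n => [|j J IH] [|x n]//= [sn] /andP[xn un].
rewrite /expand/= -/(expand J n) !count_cat !count_nseq/= eqxx mul1n.
have xE : x \notin expand J n.
  apply: contra xn; elim: J n {IH un} sn => [|j' J IH] [|x' n]//= [sn].
  rewrite /expand/= mem_cat mem_nseq in_cons => /orP[/andP[_ ->]//|/IH->//].
  by rewrite orbT.
rewrite (count_memPn xE) addn0; congr cons; rewrite -[RHS](IH n)//.
apply/eq_in_map => y yn; rewrite count_cat count_nseq/=.
by rewrite (negbTE (memPnC xn y yn)).
Qed.

Lemma sorted_expand {J n : seq nat} : size n = size J -> all (ltn 0) J ->
  sorted gtn n -> sorted geq (expand J n).
Proof.
have gtn_trans : transitive gtn := rev_trans ltn_trans.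
rewrite !sorted_pairwise//; last exact: geq_trans.
elim: J n => [|j J IH] [|x n]//= [sn] /andP[j0 J0] /andP[xn sn'].
rewrite /expand/= pairwise_cat -/(expand J n) IH// andbT; apply/andP; split.
  apply/allrelP => y z; rewrite mem_nseq mem_expand// => /andP[_ /eqP->] zn.
  exact: ltnW (allP xn z zn).
by elim: j {j0} => //= j ->; rewrite andbT all_nseq /= leqnn orbT.
Qed.

Lemma last_expand {J n : seq nat} (d : nat) :
  size n = size J -> all (ltn 0) J -> last d (expand J n) = last d n.
Proof.
elim: J n d => [|j J IH] [|x n]//= d [sn] /andP[j0 J0].
rewrite /expand/= last_cat -/(expand J n) IH//; congr last.
by case: j j0 => // j _; elim: j.
Qed.

(** Both sides are nonincreasing and have the same multiplicities. Hence [expand] is inverted by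
    reading off distinct values and their multiplicities. *)
Lemma expand_count (s : seq nat) : sorted geq s ->
  expand [seq count_mem x s | x <- undup s] (undup s) = s.
Proof.
move=> ss.
apply: (sorted_eq geq_trans geq_anti) => //.
  apply: sorted_expand; first by rewrite size_map.
    apply/allP => _ /mapP[x xs ->].
    by rewrite /= -has_count has_pred1 -mem_undup.
  by rewrite gtn_sorted_uniq_geq undup_uniq undup_sorted//; exact: geq_trans.
apply: perm_trans (perm_count_undup s).
by rewrite /expand -[X in zip _ X]map_id zip_map -map_comp.
Qed.

(** [F] may depend on the position because exponents vary inside a block; this also lets the
    induction shift past the first block. *)
Lemma prod_expand (R : realType) (J n : seq nat) (F : nat -> nat -> R) :
  size n = size J ->
  \prod_(0 <= l < sumn J) F l (nth 0%N (expand J n) l) =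
  \prod_(c < size J)
    \prod_(sumn (take c J) <= l < sumn (take c.+1 J)) F l (nth 0%N n c).
Proof.
elim: J n F => [|j J IH] [|x n]//= F.
  by rewrite big_geq// big_ord0.
move=> [sn]; rewrite big_ord_recl/= take0 /= addn0.
rewrite (big_cat_nat (n := j))/= ?leq_addr//; congr (_ * _).
  apply: eq_big_nat => l /andP[_ lj].
  by rewrite /expand/= nth_cat size_nseq lj nth_nseq lj.
rewrite -{1}[j]add0n big_addn addKn.
transitivity (\prod_(0 <= l < sumn J) F (l + j)%N (nth 0%N (expand J n) l)).
  apply: eq_bigr => l _.
  by rewrite /expand/= nth_cat size_nseq ltnNge leq_addl/= addnK.
rewrite (IH n (fun l y => F (l + j)%N y))//; apply: eq_bigr => c _.
by rewrite /= ![(j + sumn _)%N]addnC big_addn addnK.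
Qed.

(** * Multiple zeta values as sums over nonincreasing sequences *)

Lemma powRN_sum (R : realType) (I : Type) (x : R) (r : seq I) (F : I -> R) :
  0 < x -> x `^ (- \sum_(l <- r) F l) = \prod_(l <- r) x `^ (- F l).
Proof.
move=> x0; apply: (big_morph (fun y => x `^ (- y))) => [|]; last first.
  by rewrite oppr0 powRr0.
by move=> a b; rewrite opprD powRD ?lt0r_neq0 ?implybT.
Qed.

(** Entries of one block are equal, so their exponents add up to the block sum; the -1 in the last
    exponent yields the extra factor n_p, the last entry. *)
Lemma mzv_term_expand (R : realType) (I : seq R) (J n : seq nat) :
  (0 < size J)%N -> all (ltn 0) J -> mzv_index (size J) n ->
  \prod_(l < size (zeta_hat_args I J))
    (nth 0%N n l)%:R `^ (- (zeta_hat_args I J)`_l) =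
  (last 0%N (expand J n))%:R *
  \prod_(0 <= l < sumn J) (nth 0%N (expand J n) l)%:R `^ (- I`_l).
Proof.
case: J => // j J _; set p := size J; set J' := j :: J => J0 [sn gn n0].
have npos (c : 'I_(size J')) : (0 : R) < (nth 0%N n c)%:R.
  by rewrite ltr0n (allP n0)// mem_nth// sn.
rewrite -(big_mkord xpredT
  (fun l => (nth 0%N n l)%:R `^ (- (zeta_hat_args I J')`_l))).
rewrite size_mkseq big_mkord.
rewrite (eq_bigr (fun c : 'I_(size J') =>
    (nth 0%N n c)%:R `^ (c == p :> nat)%:R *
    \prod_(sumn (take c J') <= l < sumn (take c.+1 J'))
       (nth 0%N n c)%:R `^ (- I`_l))) => [|c _]; last first.
  rewrite nth_mkseq// opprB powRD ?lt0r_neq0 ?implybT// eqSS.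
  by rewrite -powRN_sum.
rewrite big_split/=; congr (_ * _).
  rewrite big_ord_recr/= big1 ?mul1r => [|c _]; last first.
    by rewrite ltn_eqF ?powRr0.
  by rewrite eqxx powRr1// last_expand// -nth_last sn.
exact: esym (@prod_expand R J' n (fun l y => y%:R `^ (- I`_l)) sn).
Qed.

(** The map (J, n) -> [expand J n] is a bijection onto the nonincreasing sequences of k positive
    integers. *)
Lemma sum_composition_esum (R : realType) (k : nat) (a : seq nat -> \bar R) :
  (forall s, 0 <= a s)%E ->
  (\sum_(J : composition k) \esum_(n in mzv_index (size J)) a (expand J n))%E =
  \esum_(s in [set s | [/\ size s = k, sorted geq s & all (ltn 0) s]]) a s.
Proof.
move=> a0; rewrite -esum_finType => [|J]; last exact: esum_ge0.
rewrite esum_esum//.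
rewrite [RHS](@reindex_esum _ _ _
    ([set: composition k] `*`` (fun J => mzv_index (size J))) _
    (fun p => expand p.1 p.2))//.
split.
- move=> [J n] [_ /= [sn gn n0]]; have /andP[J0 /eqP sJ] := valP J.
  split; first by rewrite size_expand.
    exact: sorted_expand.
  by rewrite (eq_all_r (mem_expand sn J0)).
- move=> [J n] [J' n'] /[!inE] -[_ /= [sn gn n0]] [_ /= [sn' gn' n0']] /= JJ.
  have /andP[J0 _] := valP J; have /andP[J0' _] := valP J'.
  have un : uniq n by move: gn; rewrite gtn_sorted_uniq_geq => /andP[].
  have un' : uniq n' by move: gn'; rewrite gtn_sorted_uniq_geq => /andP[].
  have nn' : n = n'.
    by rewrite -[LHS](undup_expand sn J0 un) JJ undup_expand.
  congr pair => //; apply/val_inj => /=.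
  by rewrite -[LHS](count_expand sn un) JJ nn' count_expand.
- move=> s [sk gs s0] /=.
  have kJ : is_composition k [seq count_mem x s | x <- undup s].
    apply/andP; split.
      apply/allP => _ /mapP[x xs ->].
      by rewrite -has_count has_pred1 -mem_undup.
    rewrite -sk -(size_expand (n := undup s)) ?size_map//.
    by rewrite expand_count.
  exists (Composition kJ, undup s); last exact: expand_count.
  split=> //=; split; first by rewrite size_map.
    rewrite gtn_sorted_uniq_geq undup_uniq undup_sorted//.
    exact: geq_trans.
  by apply/allP => x; rewrite mem_undup; exact: allP.
Qed.

(** * Number of permutations sorting a tuple *)

Lemma mult_fact_perm {T : eqType} (s t : seq T) :
  perm_eq s t -> mult_fact s = mult_fact t.
Proof.
move=> st; rewrite /mult_fact (perm_big _ (perm_undup (perm_mem st))).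
by apply: eq_bigr => x _; rewrite (seq.permP st).
Qed.

Definition perm_tuple {T : Type} {k : nat} (m : k.-tuple T) (s : {perm 'I_k}) :=
  [tuple tnth m (s l) | l < k].

Lemma perm_tupleK {T : Type} {k : nat} (s : {perm 'I_k}) :
  cancel (fun m : k.-tuple T => perm_tuple m s) (fun m => perm_tuple m s^-1%g).
Proof. by move=> m; apply: eq_from_tnth => l; rewrite !tnth_mktuple permKV. Qed.

Lemma perm_tuple_perm {T : eqType} {k : nat} (m : k.-tuple T)
  (s : {perm 'I_k}) : perm_eq (perm_tuple m s) m.
Proof. by apply/tuple_permP; exists s. Qed.

(** [s] sorts [m] exactly when [m] composed with [s] is the sorted tuple [w], so [card_perm_comp]
    applies. *)
Lemma sum_sorted_perm_tuple (k : nat) (m : k.-tuple nat) :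
  (\sum_(s : {perm 'I_k}) sorted geq (perm_tuple m s))%N = mult_fact m.
Proof.
pose w := sort_tuple geq m.
have wm : perm_eq w m by rewrite perm_sort.
have <- : mult_fact (codom (tnth w)) = mult_fact m.
  by rewrite codomE map_tnth_enum; exact: mult_fact_perm.
rewrite -(card_perm_comp (tnth m)) => [|x].
  apply: eq_bigr => s _; congr nat_of_bool; apply/idP/forallP => [ms l|msw].
    have <- : perm_tuple m s = w; last by rewrite tnth_mktuple.
    apply/val_inj/(sorted_eq geq_trans geq_anti) => //.
      exact: (sort_sorted geq_total).
    by rewrite (permPl (perm_tuple_perm m s)) perm_sym.
  have -> : perm_tuple m s = w.
    by apply: eq_from_tnth => l; rewrite tnth_mktuple; exact/eqP.
  exact: (sort_sorted geq_total).
have cE (t : k.-tuple nat) : (\sum_l (tnth t l == x))%N = count_mem x t.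
  rewrite -sum1_count big_tuple [RHS]big_mkcond.
  by apply: eq_bigr => l _ /=; case: (_ == x).
by rewrite !cE (seq.permP wm).
Qed.

(** The multiplicities are the parts of [J], which identifies the denominator of [zeta_hat] with the
    number of sorting permutations. *)
Lemma mult_fact_expand {J n : seq nat} :
  size n = size J -> all (ltn 0) J -> uniq n ->
  mult_fact (expand J n) = (\prod_(j <- J) j`!)%N.
Proof.
move=> sn J0 un.
by rewrite /mult_fact undup_expand// -[in RHS](count_expand sn un) big_map.
Qed.

Lemma mult_fact_gt0 {T : eqType} (s : seq T) : (0 < mult_fact s)%N.
Proof. by rewrite prodn_gt0// => x; exact: fact_gt0. Qed.

(* Multiplying the term of index n by the number 1 / (j_1! ... j_p!) makes it a
   function of the decreasing sequence [expand J n] alone. *)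
Lemma zeta_hat_expand (R : realType) (k : nat) (I : seq R)
    (J : composition k) : (0 < k)%N ->
  (mzv (zeta_hat_args I J) * ((\prod_(j <- J) (j`!)%:R)^-1)%:E =
   \esum_(n in mzv_index (size J))
     ((mult_fact (expand J n))%:R^-1 *
      ((last 0%N (expand J n))%:R *
       \prod_(0 <= l < k) (nth 0%N (expand J n) l)%:R `^ (- I`_l)))%:E)%E.
Proof.
move=> k0; have /andP[J0 /eqP sJ] := valP J.
have J_gt0 : (0 < size J)%N.
  by rewrite lt0n size_eq0; apply: contraTneq k0 => Jnil; rewrite -sJ /= Jnil.
rewrite muleC /mzv -esumZl; last 2 first.
- by rewrite invr_ge0 prodr_ge0.
- by move=> n; rewrite lee_fin prodr_ge0// => l _; rewrite powR_ge0.
rewrite [size (zeta_hat_args _ _)]size_mkseq.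
apply: eq_esum => n Jn; have [sn gn n0] := Jn.
have un : uniq n by move: gn; rewrite gtn_sorted_uniq_geq => /andP[].
rewrite mult_fact_expand// natr_prod -EFinM; congr ((_ * _)%:E).
have := mzv_term_expand _ I _ _ J_gt0 J0 Jn.
by rewrite [size (zeta_hat_args _ _)]size_mkseq sJ.
Qed.

(** * Symmetrization of the sum weighted by the minimum *)

(** Defined through sorting so that on a nonincreasing sequence it is the last entry, the factor
    supplied by [mzv_term_expand]. *)
Definition min_seq (s : seq nat) : nat := last 0%N (sort geq s).

Lemma ltn_min_seq (n : nat) (s : seq nat) : (0 < size s)%N ->
  (n < min_seq s)%N = all (ltn n) s.
Proof.
rewrite -(size_sort geq) -(perm_all _ (permEl (perm_sort geq s))) /min_seq.
move: (sort_sorted geq_total s).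
case/lastP: (sort geq s) => // t x; rewrite last_rcons all_rcons.
rewrite (sorted_pairwise geq_trans) pairwise_rcons => /andP[/allP tx _] _.
rewrite /=; case: (ltnP n x) => //= nx; apply/esym/allP => y yt /=.
exact: leq_trans nx (tx y yt).
Qed.

Lemma min_seq_sorted (s : seq nat) : sorted geq s -> min_seq s = last 0%N s.
Proof.
move=> ss; rewrite /min_seq sorted_sort//; exact: geq_trans.
Qed.

Lemma min_seq_perm (s t : seq nat) : perm_eq s t -> min_seq s = min_seq t.
Proof.
move=> st; rewrite /min_seq; congr last; apply/perm_sortP => //.
- exact: geq_total.
- exact: geq_trans.
- exact: geq_anti.
Qed.

(** Each tuple is split evenly among the permutations that sort it. For fixed [s], substituting the
    permuted tuple leaves a sum over nonincreasing sequences, which compositions organize into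
    blocks. *)
Lemma esum_min_seq (R : realType) (k : nat) (i : 'I_k -> R) : (0 < k)%N ->
  \esum_(m in [set: k.-tuple nat])
    ((min_seq m)%:R * \prod_(j < k) (tnth m j)%:R `^ (- i j))%:E =
  (\sum_(s : {perm 'I_k}) \sum_(J : composition k)
    mzv (zeta_hat_args [seq i (s j) | j : 'I_k] J) *
      ((\prod_(j <- J) (j`!)%:R)^-1)%:E)%E.
Proof.
move=> k0.
pose H (s : {perm 'I_k}) (t : seq nat) : R := (sorted geq t)%:R *
  ((mult_fact t)%:R^-1 * ((min_seq t)%:R *
   \prod_(0 <= l < k) (nth 0%N t l)%:R `^ (- [seq i (s j) | j : 'I_k]`_l))).
have H0 s t : (0 <= (H s t)%:E)%E.
  rewrite lee_fin !mulr_ge0 ?invr_ge0//; apply: prodr_ge0 => l _.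
  exact: powR_ge0.
have -> : \esum_(m in [set: k.-tuple nat])
    ((min_seq m)%:R * \prod_(j < k) (tnth m j)%:R `^ (- i j))%:E =
    \esum_(m in [set: k.-tuple nat])
      (\sum_(s : {perm 'I_k}) (H s (perm_tuple m s))%:E)%E.
  apply: eq_esum => m _; rewrite sumEFin; congr EFin.
  transitivity (\sum_(s : {perm 'I_k}) (sorted geq (perm_tuple m s))%:R *
    ((mult_fact m)%:R^-1 * ((min_seq m)%:R *
      \prod_(j < k) (tnth m j)%:R `^ (- i j)))); last first.
    apply: eq_bigr => s _.
    rewrite /H (mult_fact_perm _ m (perm_tuple_perm m s)).
    rewrite (min_seq_perm _ m (perm_tuple_perm m s)); do 3 congr (_ * _).
    (* Reindexing by [s] moves the permutation from the exponents to the entries. *)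
    rewrite big_mkord (reindex_inj (@perm_inj _ s)); apply: eq_bigr => l _.
    rewrite -tnth_nth tnth_mktuple.
    by rewrite /image_mem (nth_map l) ?size_enum_ord ?nth_ord_enum.
  rewrite -mulr_suml -natr_sum sum_sorted_perm_tuple mulrA divff ?mul1r//.
  by rewrite pnatr_eq0 -lt0n mult_fact_gt0.
rewrite esum_sum => [|m s _ _]; last exact: H0.
apply: eq_bigr => s _.
rewrite -(@reindex_esum _ _ _ setT setT (fun m => perm_tuple m s)
  (fun v : k.-tuple nat => (H s v)%:E)); last first.
  split=> //; first by move=> m m' _ _ /(can_inj (perm_tupleK s)).
  move=> m _; exists (perm_tuple m s^-1%g) => //.
  by rewrite -[in X in perm_tuple _ X](invgK s) perm_tupleK.
rewrite -(@reindex_esum _ _ _ setT [set t | size t = k] val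
  (fun t => (H s t)%:E)); last first.
  split=> //; first by move=> m _; exact: size_tuple.
  by move=> t /eqP tk; exists (Tuple tk).
transitivity (\esum_(t in
    [set t | [/\ size t = k, sorted geq t & all (ltn 0) t]])
    (H s t)%:E).
  (* Unsorted sequences are killed by the indicator, and sequences containing 0 by the factor
     [min_seq t]. *)
  rewrite esum_mkcond [RHS]esum_mkcond; apply: eq_esum => t _.
  case: ifPn => [|/negP]; rewrite inE/= => tk; last first.
    by rewrite ifF//; apply/negP; rewrite inE/= => -[/tk].
  case: ifPn => // /negP; rewrite inE/= => tN.
  congr EFin; rewrite /H.
  case: (boolP (sorted geq t)) => [st|_]; last by rewrite mul0r.
  suff -> : min_seq t = 0%N by rewrite mul0r !mulr0.
  apply/eqP; rewrite eqn0Ngt ltn_min_seq ?tk//; apply/negP => t0; exact: tN.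
rewrite -sum_composition_esum//; apply: eq_bigr => J _.
rewrite zeta_hat_expand//; apply: eq_esum => n [sn gn n0].
have /andP[J0 /eqP sJ] := valP J.
have sE := sorted_expand sn J0 gn.
by rewrite /H sE mul1r min_seq_sorted.
Qed.

(** * Zeta tails and the left-hand side *)

(** The tail is a full series with an indicator, the form [esum_tuple_prod] expects; the index 0 is
    excluded since n < 0 fails. *)
Lemma zeta_tail_cvg (R : realType) (s : R) (n : nat) : 1 < s ->
  (fun N => \sum_(0 <= m < N) (n < m)%:R * m%:R `^ (- s)) @ \oo -->
  zeta s - \sum_(1 <= m < n.+1) (m%:R `^ s)^-1.
Proof.
move=> s1; rewrite -(cvg_shiftn n.+1).
have zn : (fun N => \sum_(1 <= m < (N + n).+1) (m%:R `^ s)^-1) @ \oo --> zeta s.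
  by have := zeta_cvg _ _ s1; rewrite -(cvg_shiftn n).
under eq_fun => N.
  rewrite (big_cat_nat (n := n.+1)) ?leq_addl//=.
  rewrite big_nat_cond big1 => [|m]; last first.
    by rewrite andbT ltnS => /andP[_ mn]; rewrite ltnNge mn mul0r.
  rewrite add0r.
  rewrite (eq_big_nat _ _ (F2 := fun m => (m%:R `^ s)^-1)) => [|m]; last first.
    by case/andP => nm _; rewrite nm mul1r powRN.
  rewrite (_ : \sum_(_ <= _ < _) _ = \sum_(1 <= m < (N + n).+1) (m%:R `^ s)^-1
    - \sum_(1 <= m < n.+1) (m%:R `^ s)^-1); last first.
    rewrite [X in X - _](big_cat_nat (n := n.+1)) ?ltnS ?leq_addl//=.
    by rewrite addnS addrAC subrr add0r.
  over.
by apply: cvgB => //; exact: cvg_cst.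
Qed.

(** The product of the indicators n < m_j is the indicator of n < min m. *)
Lemma prod_zeta_tail (R : realType) (k : nat) (i : 'I_k -> R) (n : nat) :
  (0 < k)%N -> (forall j, 1 < i j) ->
  (\prod_(j < k) (zeta (i j) - \sum_(1 <= m < n.+1) (m%:R `^ i j)^-1))%:E =
  \esum_(m in [set: k.-tuple nat])
    ((n < min_seq m)%:R * \prod_(j < k) (tnth m j)%:R `^ (- i j))%:E.
Proof.
move=> k0 i1.
rewrite -(@esum_tuple_prod R k (fun j x => (n < x)%:R * x%:R `^ (- i j))).
- apply: eq_esum => m _; rewrite big_split/=; congr ((_ * _)%:E).
  rewrite ltn_min_seq ?size_tuple// -[in RHS](map_tnth_enum m) all_map.
  case: allP => [nm|nm].
    by rewrite big1// => j _; have /= -> := nm j (mem_enum _ j).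
  apply/eqP/prodf_eq0.
  have /allPn[j _ nj] : ~~ all (preim (tnth m) (ltn n)) (enum 'I_k).
    by apply/negP => /allP.
  by exists j => //; rewrite pnatr_eq0 eqb0.
- by move=> j x; rewrite mulr_ge0// powR_ge0.
- by move=> j; exact: zeta_tail_cvg.
Qed.

Lemma esum_ltn (R : realType) (c : nat) (w : R) : 0 <= w ->
  \esum_(n in [set: nat]) ((n < c)%:R * w)%:E = (c%:R * w)%:E.
Proof.
move=> w0.
transitivity (\esum_(n in `I_c) w%:E).
  rewrite [RHS]esum_mkcond; apply: eq_esum => n _.
  rewrite (_ : (n \in `I_c) = (n < c)%N); last first.
    by apply/idP/idP; rewrite inE.
  by case: ifP; rewrite (mul1r, mul0r).
rewrite esum_fset ?finite_II// -fsbig_ord sumEFin sumr_const card_ord.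
by rewrite mulr_natl.
Qed.

(** After exchanging the sums, [m] is counted once for each n with 0 <= n < min m. *)
Lemma esum_prod_zeta_tail (R : realType) (k : nat) (i : 'I_k -> R) :
  (0 < k)%N -> (forall j, 1 < i j) ->
  \esum_(n in [set: nat]) (\prod_(j < k)
    (zeta (i j) - \sum_(1 <= m < n.+1) (m%:R `^ i j)^-1))%:E =
  \esum_(m in [set: k.-tuple nat])
    ((min_seq m)%:R * \prod_(j < k) (tnth m j)%:R `^ (- i j))%:E.
Proof.
move=> k0 i1; have W0 (m : k.-tuple nat) :
    0 <= \prod_(j < k) (tnth m j)%:R `^ (- i j) :> R.
  by rewrite prodr_ge0// => j _; rewrite powR_ge0.
under eq_esum => n _ do rewrite prod_zeta_tail//.
rewrite exchange_esum => [|n m]; last by rewrite lee_fin mulr_ge0.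
by apply: eq_esum => m _; rewrite esum_ltn.
Qed.

(** * Finiteness by a weighted geometric mean *)

(* With D = sum_j (i_j - 1) > 1 and theta_j = (i_j - 1) / D, one has
   min m <= prod_j m_j^theta_j, while i_j - theta_j > 1. *)
Lemma esum_min_seq_lty (R : realType) (k : nat) (i : 'I_k -> R) :
  (0 < k)%N -> (forall j, 1 < i j) -> k.+1%:R < \sum_(j < k) i j ->
  (\esum_(m in [set: k.-tuple nat])
    ((min_seq m)%:R * \prod_(j < k) (tnth m j)%:R `^ (- i j))%:E < +oo)%E.
Proof.
move=> k0 i1 isum; pose D := \sum_(j < k) (i j - 1).
have D1 : 1 < D.
  by rewrite /D sumrB sumr_const card_ord ltrBrDr addrC natr1.
have D0 : 0 < D by exact: lt_trans D1.
pose th j := (i j - 1) / D.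
have th0 j : 0 <= th j by rewrite divr_ge0 ?subr_ge0 ?(ltW D0) ?(ltW (i1 j)).
have sum_th : \sum_(j < k) th j = 1 by rewrite -mulr_suml divff ?gt_eqF.
(* Indeed i_j - 1 = D theta_j > theta_j, since D > 1 and theta_j > 0. *)
have ith j : 1 < i j - th j.
  by rewrite ltrBrDl -ltrBrDr /th ltr_pdivrMr// ltr_pMr ?subr_gt0.
(* At n = 0 the tails are full zeta values, so the majorant sums to the finite product of zeta(i_j -
   theta_j). *)
have := @prod_zeta_tail R k (fun j => i j - th j) 0%N k0 ith.
set L := \prod_(j < k) _ => LE.
apply: le_lt_trans (ltry L); rewrite LE.
apply: le_esum => m _; rewrite lee_fin.
(* Tuples containing 0 have weight 0 on both sides. *)
have [->|m0] := posnP (min_seq m); first by rewrite !mul0r.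
rewrite mul1r.
have m0R : (0 : R) < (min_seq m)%:R by rewrite ltr0n.
have min_le j : (min_seq m <= tnth m j)%N.
  have := leqnn (min_seq m); rewrite -{1}(prednK m0) ltn_min_seq ?size_tuple//.
  by move=> /allP/(_ _ (mem_tnth j m)) /=; rewrite prednK.
have t0 j : (0 : R) < (tnth m j)%:R.
  by rewrite ltr0n (leq_trans m0).
have -> : (min_seq m)%:R = \prod_(j < k) (min_seq m)%:R `^ th j :> R.
  under [RHS]eq_bigr do rewrite -[th _]opprK.
  by rewrite -powRN_sum// sumrN opprK sum_th powRr1.
rewrite -big_split/=; apply: ler_prod => j _.
rewrite mulr_ge0 ?powR_ge0//= opprB powRD ?lt0r_neq0 ?implybT//.
by rewrite ler_wpM2r ?powR_ge0// ge0_ler_powR ?nnegrE// ler_nat.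
Qed.

(** * Passage from sums in [0, +oo] to real limits *)

Theorem theorem8 (R : realType) (k : nat) (i : 'I_k -> R)
    (hk : (2 <= k)%N) (hi : forall j : 'I_k, 1 < i j)
    (hsum : k.+1%:R < \sum_(j < k) i j) :
  (forall (s : {perm 'I_k}) (J : composition k),
     mzv (zeta_hat_args [seq i (s j) | j : 'I_k] J) \is a fin_num) /\
  (fun N : nat => \sum_(1 <= n < N.+1) \prod_(j < k)
     (zeta (i j) - \sum_(1 <= m < n.+1) (m%:R `^ i j)^-1)) @ \oo -->
  (\sum_(s : {perm 'I_k}) \sum_(J : composition k)
     zeta_hat [seq i (s j) | j : 'I_k] J) - \prod_(j < k) zeta (i j).
Proof.
have k0 : (0 < k)%N by exact: ltn_trans hk.
have mzv0 (a : seq R) : (0 <= mzv a)%E.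
  apply: esum_ge0 => n _; rewrite lee_fin; apply: prodr_ge0 => l _.
  exact: powR_ge0.
have fact_gt0 (J : seq nat) : (0 : R) < (\prod_(j <- J) (j`!)%:R)^-1.
  by rewrite invr_gt0 prodr_gt0// => j _; rewrite ltr0n fact_gt0.
have S_lty := esum_min_seq_lty _ _ _ k0 hi hsum.
have SE := @esum_min_seq R k i k0.
have term_ge0 (s : {perm 'I_k}) (J : composition k) :
    (0 <= mzv (zeta_hat_args [seq i (s j) | j : 'I_k] J) *
      ((\prod_(j <- J) (j`!)%:R)^-1)%:E)%E.
  by rewrite mule_ge0// lee_fin ltW.
(* An infinite value, with its positive coefficient, would make the whole nonnegative sum
   infinite. *)
have mzv_fin (s : {perm 'I_k}) (J : composition k) :
    mzv (zeta_hat_args [seq i (s j) | j : 'I_k] J) \is a fin_num.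
  rewrite ge0_fin_numE//; apply: contraTT S_lty.
  rewrite -!leNgt !leye_eq => /eqP mzvy; rewrite SE -leye_eq.
  rewrite (bigD1 s)//= (bigD1 J)//= mzvy gt0_mulye ?lte_fin//.
  by rewrite -addeA leeDl// adde_ge0// sume_ge0// => *; rewrite sume_ge0.
split=> //.
pose T (n : nat) :=
  \prod_(j < k) (zeta (i j) - \sum_(1 <= m < n.+1) (m%:R `^ i j)^-1).
have T0 : T 0%N = \prod_(j < k) zeta (i j).
  by apply: eq_bigr => j _; rewrite big_geq// subr0.
have T_ge0 n : (0 <= (T n)%:E)%E.
  rewrite prod_zeta_tail//; apply: esum_ge0 => m _.
  by rewrite lee_fin mulr_ge0// prodr_ge0// => j _; rewrite powR_ge0.
set S := \sum_(s : {perm 'I_k}) _.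
(* The series started at n = 0 has the double sum as its limit; finiteness makes [fine] harmless in
   [zeta_hat]. *)
have TS : (fun N => \sum_(0 <= n < N) T n) @ \oo --> S.
  have : \esum_(n in [set: nat]) (T n)%:E = S%:E.
    rewrite esum_prod_zeta_tail// SE /S -sumEFin; apply: eq_bigr => s _.
    rewrite -sumEFin; apply: eq_bigr => J _.
    by rewrite /zeta_hat EFinM fineK.
  rewrite -nneseries_esumT// => TS.
  have : (fun N => \sum_(0 <= n < N) (T n)%:E)%E @ \oo --> S%:E.
    by rewrite -TS; apply: is_cvg_nneseries.
  by under eq_fun do rewrite sumEFin; move/fine_cvg.
(* Dropping the term n = 0, the product of the zeta values, gives the stated series. *)
under eq_fun => N.
  rewrite (_ : \sum_(_ <= _ < _) _ =
    \sum_(0 <= n < N.+1) T n - T 0%N); last first.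
    by rewrite [in RHS]big_ltn// addrAC subrr add0r.
  over.
rewrite -T0; apply: cvgB; last exact: cvg_cst.
by rewrite (cvg_shiftS (fun N => \sum_(0 <= n < N) T n)).
Qed.
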